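(* Let $f_n$ ($n\ge1$) be the number of rows with the value ''false'' in the Kleene truth tables of all bracketed formulae with $n$ distinct variables $p_1,\dots,p_n$ connected by implication, and let $C_n=\frac1n\binom{2n-2}{n-1}$. Then $f_1=1$ and, for all $n\ge2$, $$f_n=\sum_{i=1}^{n-1}f_i\left(2\,C_{n-i}\,3^{n-i-1}-f_{n-i}\right).$$ Moreover the generating function $F(x)=\sum_{n\ge1}f_nx^n$ is $$F(x)=\frac{-2-\sqrt{1-12x}+\sqrt{5+24x+4\sqrt{1-12x}}}{6}.$$
   Context: Truth values are $1$ (true), $0$ (false), $2$ (unknown). The Kleene implication on $\{0,1,2\}$ is: $1\Rightarrow 1=1$, $1\Rightarrow 0=0$, $1\Rightarrow 2=2$; $0\Rightarrow b=1$ for every $b$; $2\Rightarrow 1=1$, $2\Rightarrow 0=2$, $2\Rightarrow 2=2$. A bracketed formula with $n$ distinct variables is a formula obtained from $p_1\Rightarrow p_2\Rightarrow\cdots\Rightarrow p_n$ by a complete bracketing (equivalently, a full binary tree with $n$ leaves labelled $p_1,\dots,p_n$ from left to right and every internal node labelled $\Rightarrow$); for $n=1$ the only one is $p_1$. A row of the truth table of such a formula is an assignment of $\{0,1,2\}$-values to $p_1,\dots,p_n$, and its value is the value of the formula under this assignment. Counting rows in all truth tables means counting pairs (bracketed formula, assignment). Generating functions are read as formal power series (equivalently, analytic functions near $0$), with $\sqrt{1-12x}$ the square root having constant term $1$ and $\sqrt{5+24x+4\sqrt{1-12x}}$ the square root having constant term $3$. *)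

(* Defs.v *)
(* MathComp, with mathcomp.classical for function extensionality and choice. *)
From HB Require Import structures.
From mathcomp Require Import all_boot all_order all_algebra.
From mathcomp Require Import boolp classical_sets.

Set Implicit Arguments.
Unset Strict Implicit.
Unset Printing Implicit Defensive.

Import GRing.Theory.

(* [KTrue], [KFalse], [KUnknown] are the truth values 1, 0, 2. *)
Inductive kleene := KTrue | KFalse | KUnknown.

Definition kleene_code (a : kleene) : option bool :=
  match a with KTrue => Some true | KFalse => Some false | KUnknown => None end.

Definition kleene_decode (o : option bool) : kleene :=
  match o with Some true => KTrue | Some false => KFalse | None => KUnknown end.

Lemma kleene_codeK : cancel kleene_code kleene_decode.
Proof. by case. Qed.

HB.instance Definition _ := Equality.copy kleene (can_type kleene_codeK).
HB.instance Definition _ := Choice.copy kleene (can_type kleene_codeK).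
HB.instance Definition _ := Countable.copy kleene (can_type kleene_codeK).
HB.instance Definition _ := Finite.copy kleene (can_type kleene_codeK).

Definition kimp (a b : kleene) : kleene :=
  match a, b with
  | KTrue, _ => b
  | KFalse, _ => KTrue
  | KUnknown, KTrue => KTrue
  | KUnknown, KFalse => KUnknown
  | KUnknown, KUnknown => KUnknown
  end.

Inductive formula (n : nat) :=
  | Var of 'I_n
  | Imp of formula n & formula n.

Section FormulaStructures.

Variable n : nat.

Fixpoint formula_encode (t : formula n) : GenTree.tree 'I_n :=
  match t with
  | Var i => GenTree.Leaf i
  | Imp t1 t2 => GenTree.Node 0 [:: formula_encode t1; formula_encode t2]
  end.

Fixpoint formula_decode (t : GenTree.tree 'I_n) : option (formula n) :=
  match t with
  | GenTree.Leaf i => Some (Var i)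
  | GenTree.Node _ [:: t1; t2] =>
      if (formula_decode t1, formula_decode t2) is (Some u1, Some u2)
      then Some (Imp u1 u2) else None
  | _ => None
  end.

Lemma formula_encodeK : pcancel formula_encode formula_decode.
Proof. by elim=> //= t1 -> t2 ->. Qed.

End FormulaStructures.

HB.instance Definition _ n :=
  Equality.copy (formula n) (pcan_type (@formula_encodeK n)).
HB.instance Definition _ n :=
  Choice.copy (formula n) (pcan_type (@formula_encodeK n)).
HB.instance Definition _ n :=
  Countable.copy (formula n) (pcan_type (@formula_encodeK n)).

Fixpoint leaves n (t : formula n) : seq 'I_n :=
  match t with
  | Var i => [:: i]
  | Imp t1 t2 => leaves t1 ++ leaves t2
  end.

Fixpoint eval n (v : 'I_n -> kleene) (t : formula n) : kleene :=
  match t with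
  | Var i => v i
  | Imp t1 t2 => kimp (eval v t1) (eval v t2)
  end.

(* The variables p_1, ..., p_n are the elements 0, ..., n - 1 of ['I_n]; a
   complete bracketing of p_1 => ... => p_n is a formula whose leaves, read from
   left to right, are exactly these. There is none for n = 0. *)
Record bracketed (n : nat) := Bracketed {
  bracketed_val :> formula n;
  _ : leaves bracketed_val == enum 'I_n
}.

HB.instance Definition _ n := [isSub for @bracketed_val n].
HB.instance Definition _ n := [Countable of bracketed n by <:].

Section BracketedFinite.

Variable n : nat.

(* All the formulae of height less than [k]. *)
Fixpoint formulae (k : nat) : seq (formula n) :=
  if k is k'.+1 then
    [seq Var i | i <- enum 'I_n]
      ++ [seq Imp t1 t2 | t1 <- formulae k', t2 <- formulae k']
  else [::].

Lemma mem_formulae k (t : formula n) : size (leaves t) <= k -> t \in formulae k.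
Proof.
have leaves_gt0 (u : formula n) : 0 < size (leaves u).
  by elim: u => //= u1 IH1 u2 _; rewrite size_cat addn_gt0 IH1.
elim: k t => [|k IHk] t; first by rewrite leqNgt leaves_gt0.
case: t => [i _|t1 t2] /=; rewrite mem_cat; first by rewrite map_f ?mem_enum.
rewrite size_cat => le_k; apply/orP; right; apply: allpairs_f; apply: IHk.
  by rewrite -ltnS; apply: leq_trans le_k; rewrite -addn1 leq_add2l leaves_gt0.
by rewrite -ltnS; apply: leq_trans le_k; rewrite -add1n leq_add2r leaves_gt0.
Qed.

Definition bracketed_enum : seq (bracketed n) :=
  undup (pmap insub (formulae n)).

Lemma bracketed_enumP : Finite.axiom bracketed_enum.
Proof.
apply: Finite.uniq_enumP; first exact: undup_uniq.
move=> t; rewrite mem_undup mem_pmap_sub /= mem_formulae //.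
by case: t => t /= /eqP->; rewrite size_enum_ord.
Qed.

HB.instance Definition _ := isFinite.Build (bracketed n) bracketed_enumP.

End BracketedFinite.

Definition false_rows (n : nat) : nat :=
  #|[set r : bracketed n * {ffun 'I_n -> kleene} | eval r.2 r.1 == KFalse]|.

Local Open Scope ring_scope.

Definition catalan (n : nat) : rat := n%:R^-1 * 'C(2 * n - 2, n - 1)%:R.

(* Formal power series over the rationals, as the commutative Q-algebra of
   coefficient sequences with the Cauchy product. *)
Record fps := Fps { fps_coef :> nat -> rat }.

Lemma fps_coefK : cancel fps_coef Fps.
Proof. by case. Qed.

HB.instance Definition _ := Equality.copy fps (can_type fps_coefK).
HB.instance Definition _ := Choice.copy fps (can_type fps_coefK).

Lemma fpsP (A B : fps) : A =1 B -> A = B.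
Proof. by case: A B => [a] [b] /= eq_ab; congr Fps; apply/funext. Qed.

Definition fps_zero := Fps (fun=> 0).
Definition fps_opp (A : fps) := Fps (fun n => - A n).
Definition fps_add (A B : fps) := Fps (fun n => A n + B n).

Fact fps_addA : associative fps_add.
Proof. by move=> A B C; apply: fpsP => n /=; rewrite addrA. Qed.
Fact fps_addC : commutative fps_add.
Proof. by move=> A B; apply: fpsP => n /=; rewrite addrC. Qed.
Fact fps_add0 : left_id fps_zero fps_add.
Proof. by move=> A; apply: fpsP => n /=; rewrite add0r. Qed.
Fact fps_addN : left_inverse fps_zero fps_opp fps_add.
Proof. by move=> A; apply: fpsP => n /=; rewrite addNr. Qed.

HB.instance Definition _ :=
  GRing.isZmodule.Build fps fps_addA fps_addC fps_add0 fps_addN.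

Definition fps_one := Fps (fun n => (n == 0%N)%:R).
Definition fps_mul (A B : fps) :=
  Fps (fun n => \sum_(i < n.+1) A i * B (n - i)%N).

(* Coefficients of products only depend on truncations, which reduces the ring
   axioms to those of polynomials. *)
Definition fps_trunc (N : nat) (A : fps) : {poly rat} := \poly_(i < N) A i.

Lemma fps_mulE N n (A B : fps) : (n < N)%N ->
  fps_mul A B n = (fps_trunc N A * fps_trunc N B)`_n.
Proof.
move=> lt_nN; rewrite coefM; apply: eq_bigr => -[i /= le_in] _.
rewrite !coef_poly (leq_trans le_in lt_nN).
by rewrite (leq_ltn_trans (leq_subr i n) lt_nN).
Qed.

Fact fps_mulC : commutative fps_mul.
Proof. by move=> A B; apply: fpsP => n; rewrite !(@fps_mulE n.+1) // mulrC. Qed.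

Fact fps_mulA : associative fps_mul.
Proof.
move=> A B C; apply: fpsP => n.
transitivity ((fps_trunc n.+1 A * (fps_trunc n.+1 B * fps_trunc n.+1 C))`_n).
  rewrite coefM; apply: eq_bigr => -[i /= le_in] _.
  by rewrite coef_poly le_in -fps_mulE // ltnS leq_subr.
rewrite mulrA coefM; apply: eq_bigr => -[i /= le_in] _.
by rewrite -fps_mulE // coef_poly ltnS leq_subr.
Qed.

Fact fps_mul1 : left_id fps_one fps_mul.
Proof.
move=> A; apply: fpsP => n /=; rewrite big_ord_recl /= mul1r subn0 big1 ?addr0 //.
by move=> i _; rewrite mul0r.
Qed.

Fact fps_mulDl : left_distributive fps_mul fps_add.
Proof.
move=> A B C; apply: fpsP => n /=; rewrite -big_split /=.
by apply: eq_bigr => i _; rewrite mulrDl.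
Qed.

Fact fps_one_neq0 : fps_one != 0.
Proof. by apply/eqP=> /(congr1 (fun A : fps => A 0%N)). Qed.

HB.instance Definition _ := GRing.Zmodule_isComNzRing.Build fps
  fps_mulA fps_mulC fps_mul1 fps_mulDl fps_one_neq0.

Definition fps_scale (c : rat) (A : fps) := Fps (fun n => c * A n).

Fact fps_scaleA (c d : rat) (A : fps) :
  fps_scale c (fps_scale d A) = fps_scale (c * d) A.
Proof. by apply: fpsP => n /=; rewrite mulrA. Qed.
Fact fps_scale1 : left_id 1 fps_scale.
Proof. by move=> A; apply: fpsP => n /=; rewrite mul1r. Qed.
Fact fps_scaleDr : right_distributive fps_scale +%R.
Proof. by move=> c A B; apply: fpsP => n /=; rewrite mulrDr. Qed.
Fact fps_scaleDl (A : fps) : {morph fps_scale^~ A : c d / c + d}.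
Proof. by move=> c d; apply: fpsP => n /=; rewrite mulrDl. Qed.

HB.instance Definition _ := GRing.Zmodule_isLmodule.Build rat fps
  fps_scaleA fps_scale1 fps_scaleDr fps_scaleDl.

Definition fpsX : fps := Fps (fun n => (n == 1%N)%:R).

(* [fps_sqrt c A] is the square root of [A] with constant term [c]; it exists
   and is unique as soon as c <> 0 and c ^ 2 is the constant term of [A]. *)
Definition fps_sqrt (c : rat) (A : fps) : fps :=
  xget 0 [set S : fps | S ^+ 2 = A /\ S 0%N = c]%classic.

Lemma fps_coefM (A B : fps) n : (A * B) n = \sum_(i < n.+1) A i * B (n - i)%N.
Proof. by []. Qed.

Lemma fps_sqr_coefS (S : fps) n :
  (S ^+ 2) n.+1 =
    2%:R * S 0%N * S n.+1 + \sum_(i < n) S i.+1 * S (n - i)%N.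
Proof.
rewrite expr2 fps_coefM big_ord_recl big_ord_recr /= subn0 /bump /= !add1n subnn.
rewrite addrCA addrC; congr (_ + _).
by rewrite (mulrC (S n.+1)) -mulrA mulr_natl mulr2n.
Qed.

Fixpoint fps_sqrt_seq (c : rat) (A : fps) (n : nat) : seq rat :=
  if n is n'.+1 then
    let s := fps_sqrt_seq c A n' in
    rcons s ((A n - \sum_(i < n') s`_i.+1 * s`_(n' - i)) / (2%:R * c))
  else [:: c].

Lemma fps_sqrt_exists c (A : fps) : c != 0 -> A 0%N = c ^+ 2 ->
  exists S : fps, S ^+ 2 = A /\ S 0%N = c.
Proof.
move=> c_neq0 A0; have c2_neq0 : 2%:R * c != 0 by rewrite mulf_neq0.
pose L := fps_sqrt_seq c A; pose S := Fps (fun n => (L n)`_n).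
have size_L n : size (L n) = n.+1.
  by elim: n => //= n IHn; rewrite size_rcons -/(L n) IHn.
have nth_L n i : (i <= n)%N -> (L n)`_i = S i.
  elim: n => [|n IHn]; first by rewrite leqn0 => /eqP->.
  rewrite leq_eqVlt => /predU1P[-> // | lt_in].
  by rewrite [L _]/= nth_rcons -/(L n) size_L lt_in IHn.
exists S; split=> //; apply: fpsP => -[|n].
  by rewrite expr2 fps_coefM big_ord1 A0 expr2.
rewrite fps_sqr_coefS.
have -> : S n.+1 = (A n.+1 - \sum_(i < n) S i.+1 * S (n - i)%N) / (2%:R * c).
  rewrite [LHS]/= nth_rcons -/(L n) size_L ltnn eqxx; congr ((_ - _) / _).
  by apply: eq_bigr => i _; rewrite !nth_L ?leq_subr.
by rewrite [S 0%N]/= mulrC divfK // subrK.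
Qed.

Lemma fps_sqrt_inj c (S T : fps) : c != 0 ->
  S ^+ 2 = T ^+ 2 -> S 0%N = c -> T 0%N = c -> S = T.
Proof.
move=> c_neq0 eqST S0 T0; have c2_neq0 : 2%:R * c != 0 by rewrite mulf_neq0.
apply: fpsP => n; have [m] := ubnP n; elim: m n => // m IHm [|n].
  by rewrite S0 T0.
rewrite ltnS => le_nm; have := congr1 (fun U : fps => U n.+1) eqST.
rewrite !fps_sqr_coefS S0 T0.
rewrite [X in _ + X](eq_bigr (fun i : 'I_n => T i.+1 * T (n - i)%N)).
  by move=> /addIr /(mulfI c2_neq0).
move=> i _; have lt_nm : (n < m)%N by [].
by rewrite !IHm // ?(leq_ltn_trans _ lt_nm) ?leq_subr // ltn_ord.
Qed.

Lemma fps_sqrtP c (A : fps) : c != 0 -> A 0%N = c ^+ 2 ->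
  fps_sqrt c A ^+ 2 = A /\ fps_sqrt c A 0%N = c.
Proof. by move=> c_neq0 A0; apply: xgetPex (fps_sqrt_exists c_neq0 A0). Qed.

Lemma fps_sqrt_unique c (A S : fps) : c != 0 ->
  S ^+ 2 = A -> S 0%N = c -> fps_sqrt c A = S.
Proof.
move=> c_neq0 SA S0; apply: xget_unique => // T [TA T0].
by apply: (@fps_sqrt_inj c) => //; rewrite TA.
Qed.

(* Main.v *)
(** A row is the same thing as a full binary tree with truth values at its
    leaves, so splitting at the root gives, for the generating functions T, F, U
    of the rows with value true, false, unknown:
      F = x + F T,   U = x + U S,   S = 3 x + S ^ 2,   where S = T + F + U.
    The last two equations force S = 3 U, hence T = 2 U - F = (2/3) S - F, and
    F = x + F T becomes both the recurrence and a quadratic equation for F over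
    Q(U), with 1 - 6 U = sqrt (1 - 12 x). The coefficients 3 ^ n C_n of S come
    from (1 - 12 x) S' = 3 - 6 S. *)
Require Import Defs.
From mathcomp Require Import all_boot all_order all_algebra.
From mathcomp Require Import ring.

Set Implicit Arguments.
Unset Strict Implicit.
Unset Printing Implicit Defensive.

Import GRing.Theory Num.Theory.
Local Open Scope ring_scope.

(** * Formulae with arbitrary leaf labels, classified by number of leaves *)

Section Trees.

Variable m : nat.
Implicit Types w : formula m.

Lemma leaves_gt0 w : (0 < size (leaves w))%N.
Proof. by elim: w => //= w1 IH1 w2 _; rewrite size_cat addn_gt0 IH1. Qed.

(** Labels are unconstrained, unlike in [bracketed], so both subtrees of a tree are again trees over
    the same label set ['I_m]. *)
Definition trees n : seq (formula m) :=
  undup [seq w <- formulae m n | size (leaves w) == n].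

Lemma mem_trees n w : (w \in trees n) = (size (leaves w) == n).
Proof.
rewrite mem_undup mem_filter; case: eqP => //= size_w.
by rewrite mem_formulae // size_w.
Qed.

Lemma trees_uniq n : uniq (trees n).
Proof. exact: undup_uniq. Qed.

Lemma trees0 : trees 0 = [::].
Proof.
case E: (trees 0) => [//|w s]; have := mem_trees 0 w.
by rewrite E inE eqxx eqn0Ngt leaves_gt0.
Qed.

Lemma trees1 : perm_eq (trees 1) [seq Var i | i <- enum 'I_m].
Proof.
apply: uniq_perm; first exact: trees_uniq.
  by rewrite map_inj_uniq ?enum_uniq // => i j [].
move=> [i|w1 w2]; rewrite mem_trees.
  by rewrite eqxx map_f ?mem_enum.
rewrite /= size_cat gtn_eqF ?(leq_add (leaves_gt0 w1) (leaves_gt0 w2)) //.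
by apply/esym/mapP => -[].
Qed.

Lemma treesS n : (1 < n)%N ->
  perm_eq (trees n)
    [seq Imp p.1 p.2 | i <- index_iota 1 n,
                       p <- [seq (w1, w2) | w1 <- trees i, w2 <- trees (n - i)%N]].
Proof.
move=> n_gt1; apply: uniq_perm; first exact: trees_uniq.
- apply: allpairs_uniq_dep; first exact: iota_uniq.
    by move=> i _; apply: allpairs_uniq; rewrite ?trees_uniq // => -[? ?] [? ?].
  (* The index [i] is recovered as the leaf count of the left subtree, so no tree is listed
     twice. *)
  move=> _ _ /allpairsPdep[i [p [_ ip ->]]] /allpairsPdep[j [q [_ jq ->]]] /=.
  case/allpairsPdep: ip => p1 [p2 [+ _ ->]] /=.
  case/allpairsPdep: jq => q1 [q2 [+ _ ->]] /=.
  by rewrite !mem_trees => /eqP<- /eqP<- [-> ->].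
case=> [i|w1 w2]; rewrite mem_trees /=.
  rewrite (ltn_eqF n_gt1); apply/esym/negP.
  by case/allpairsPdep=> j [p [_ _]].
rewrite size_cat; apply/eqP/allpairsPdep => [size_w|].
  exists (size (leaves w1)), (w1, w2); split=> //.
    by rewrite mem_index_iota leaves_gt0 -size_w -addn1 leq_add2l leaves_gt0.
  by apply: allpairs_f; rewrite mem_trees // -size_w addKn.
case=> i [p [+ ip [-> ->]]]; rewrite mem_index_iota => /andP[_ lt_in].
case/allpairsPdep: ip => p1 [p2 [+ + ->]] /=.
by rewrite !mem_trees => /eqP-> /eqP->; rewrite subnKC // ltnW.
Qed.

End Trees.

(** * Relabelling of leaves, and rows as trees of truth values *)

Section Relabel.

Variables n m : nat.
Implicit Types (f g : 'I_n -> 'I_m) (t u : formula n).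

Fixpoint relabel f t : formula m :=
  match t with
  | Var i => Var (f i)
  | Imp t1 t2 => Imp (relabel f t1) (relabel f t2)
  end.

Lemma leaves_relabel f t : leaves (relabel f t) = [seq f i | i <- leaves t].
Proof. by elim: t => //= t1 -> t2 ->; rewrite map_cat. Qed.

Lemma eval_relabel f (v : 'I_m -> kleene) t :
  eval v (relabel f t) = eval (v \o f) t.
Proof. by elim: t => //= t1 -> t2 ->. Qed.

(** Relabelling keeps the shape and the leaf list gives back the labels. Two maps are allowed
    because each row relabels by its own assignment. *)
Lemma relabel_inj f g t u :
  relabel f t = relabel g u -> leaves t = leaves u -> t = u.
Proof.
elim: t u => [i|t1 IH1 t2 IH2] [j|u1 u2] //=; first by move=> _ [->].
case=> eq1 eq2 /eqP; rewrite eqseq_cat.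
  by case/andP=> /eqP/IH1-> // /eqP/IH2->.
by rewrite -(size_map f) -(size_map g) -!leaves_relabel eq1.
Qed.

Lemma relabel_onto f (s : seq 'I_n) (w : formula m) :
  leaves w = [seq f i | i <- s] ->
  exists2 t, leaves t = s & relabel f t = w.
Proof.
elim: w s => [j|w1 IH1 w2 IH2] s /=.
  by case: s => [|i [|? ?]] //= [->]; exists (Var i).
move=> eq_s; have := eq_s.
(* Cutting [s] at the leaf count of [w1] gives the leaf lists of the two subtrees sought. *)
rewrite -(cat_take_drop (size (leaves w1)) s) map_cat => /eqP.
have size_s : size s = (size (leaves w1) + size (leaves w2))%N.
  by rewrite -size_cat eq_s size_map.
rewrite eqseq_cat; last by rewrite size_map size_takel // size_s leq_addr.
case/andP=> /eqP/IH1[t1 <- <-] /eqP/IH2[t2 <- <-].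
by exists (Imp t1 t2).
Qed.

End Relabel.

(* A row is recorded as a single tree, whose leaves carry the truth values. *)
Definition truth := #|{: kleene}|.
Definition value (w : formula truth) : kleene := eval enum_val w.

Definition rows (a : kleene) (n : nat) : nat :=
  count (fun w => value w == a) (trees truth n).

(** Replacing each variable by the rank of its value is a bijection from rows to trees with [n]
    leaves: the variables are distinct, so any labelling of the leaves is an assignment. *)
Lemma card_rows a n :
  #|[set r : bracketed n * {ffun 'I_n -> kleene} | eval r.2 r.1 == a]| = rows a n.
Proof.
pose row (r : bracketed n * {ffun 'I_n -> kleene}) :=
  relabel (fun i => enum_rank (r.2 i)) (bracketed_val r.1).
have leaves_br (t : bracketed n) : leaves t = enum 'I_n by case: t => t /= /eqP.
have value_row r : value (row r) = eval r.2 r.1.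
  rewrite /value eval_relabel; elim: (bracketed_val r.1) => //= [i|t1 -> t2 -> //].
  by rewrite enum_rankK.
have row_inj : injective row.
  move=> [t f] [u g] eq_tu; congr (_, _).
    by apply/val_inj/(relabel_inj eq_tu); rewrite /= !leaves_br.
  move: (congr1 (@leaves truth) eq_tu); rewrite !leaves_relabel /= !leaves_br.
  by move/eq_in_map => eq_fg; apply/ffunP => i; apply/enum_rank_inj/eq_fg/mem_enum.
rewrite cardE -(size_map row) /rows -size_filter.
apply/perm_size/uniq_perm.
- by rewrite map_inj_uniq ?enum_uniq.
- exact/filter_uniq/trees_uniq.
move=> w; rewrite mem_filter mem_trees; apply/mapP/andP => [[r]|[/eqP val_w /eqP size_w]].
  rewrite mem_enum inE -value_row => val_r ->; split=> //.
  by rewrite leaves_relabel leaves_br size_map size_enum_ord.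
(* The assignment read off [w]: variable [i] gets the truth value at leaf [i]. *)
pose f := [ffun i : 'I_n => enum_val (tnth (Tuple (introT eqP size_w)) i)].
have /relabel_onto[t /eqP leaves_t eq_w] :
    leaves w = [seq enum_rank (f i) | i <- enum 'I_n].
  rewrite -[LHS](map_tnth_enum (Tuple (introT eqP size_w))).
  by apply: eq_map => i; rewrite ffunE enum_valK.
have eq_row : w = row (Bracketed leaves_t, f) by [].
by exists (Bracketed leaves_t, f); rewrite // mem_enum inE -value_row -eq_row val_w.
Qed.

(** * Recursion for the row counts *)

Lemma rows0 a : rows a 0 = 0%N.
Proof. by rewrite /rows trees0. Qed.

Lemma rows1 a : rows a 1 = 1%N.
Proof.
rewrite /rows (permP (trees1 _)) count_map.
rewrite (eq_count (a2 := pred1 (enum_rank a))).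
  by rewrite count_uniq_mem ?enum_uniq // mem_enum.
by move=> i; rewrite /value /= (can2_eq enum_valK enum_rankK).
Qed.

Lemma count_allpairs_pair (S T : Type) (P : pred S) (Q : pred T) s t :
  count (fun p => P p.1 && Q p.2) [seq (x, y) | x <- s, y <- t] =
  (count P s * count Q t)%N.
Proof.
elim: s => //= x s IHs; rewrite count_cat count_map {}IHs mulnDl; congr (_ + _)%N.
by case Px: (P x); rewrite ?mul1n ?mul0n /preim /= Px //= count_pred0.
Qed.

Lemma rowsS a n : (1 < n)%N ->
  rows a n = (\sum_(1 <= i < n) \sum_(p : kleene * kleene | kimp p.1 p.2 == a)
    rows p.1 i * rows p.2 (n - i))%N.
Proof.
move=> n_gt1; rewrite /rows (permP (treesS _ n_gt1)).
rewrite count_flatten -map_comp sumnE big_map; apply: eq_bigr => i _ /=.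
rewrite count_map.
under eq_bigr do rewrite -count_allpairs_pair -sum1_count.
(* With the sum over [(w1, w2)] outside, only the pair of values [(value w1, value w2)] can
   contribute, and it does so exactly when its implication is [a]. *)
rewrite (exchange_big_dep predT) //= -sum1_count big_mkcond.
apply: eq_bigr => -[w1 w2] _ /=; rewrite /value /= -/(value w1) -/(value w2).
rewrite sum1_card; case: ifP => [val_w | /negP val_w].
  rewrite -(card1 (value w1, value w2)); apply: eq_card => -[b c].
  rewrite inE unfold_in /= xpair_eqE [b == _]eq_sym [c == _]eq_sym.
  case: (value w1 =P b) => [<-|_]; last by rewrite andbF.
  by case: (value w2 =P c) => [<-|_]; rewrite ?val_w ?andbF.
apply/esym/eq_card0 => -[b c]; rewrite unfold_in /=.
by apply/and3P => -[bc_a /eqP w1b /eqP w2c]; case: val_w; rewrite w1b w2c.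
Qed.

(** * Generating functions *)

Definition rows_fps a : fps := Fps (fun n => (rows a n)%:R).

Lemma fps_coefD (A B : fps) n : (A + B) n = A n + B n.
Proof. by []. Qed.

Lemma fps_coefB (A B : fps) n : (A - B) n = A n - B n.
Proof. by []. Qed.

Lemma fps_coef_sum (I : finType) (P : pred I) (A : I -> fps) n :
  (\sum_(i | P i) A i) n = \sum_(i | P i) A i n.
Proof. exact: (big_morph (fun B : fps => B n)). Qed.

Lemma fps_mul_nat_coef k (A : fps) n : (k%:R * A) n = k%:R * A n.
Proof.
rewrite !mulr_natl; elim: k => [|k IHk]; first by rewrite !mulr0n.
by rewrite !mulrS fps_coefD IHk.
Qed.

Lemma fps_coefM_inner (A B : fps) n : A 0%N = 0 -> B 0%N = 0 ->
  (A * B) n = \sum_(1 <= i < n) A i * B (n - i)%N.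
Proof.
move=> A0 B0; rewrite fps_coefM -(big_mkord xpredT (fun i => A i * B (n - i)%N)).
case: n => [|n]; first by rewrite big_nat1 A0 mul0r big_geq.
by rewrite big_nat_recr //= subnn B0 mulr0 addr0 big_ltn // A0 mul0r add0r.
Qed.

(** The term [fpsX] is the single leaf labelled [a]; the products come from splitting at the
    root. *)
Lemma rows_fpsE a :
  rows_fps a =
    fpsX + \sum_(p | kimp p.1 p.2 == a) rows_fps p.1 * rows_fps p.2.
Proof.
apply: fpsP => n; rewrite fps_coefD fps_coef_sum.
under eq_bigr do rewrite fps_coefM_inner /= ?rows0 //.
case: n => [|[|n]] /=.
- by rewrite rows0 big1 ?addr0 // => p _; rewrite big_geq.
- by rewrite rows1 big1 ?addr0 // => p _; rewrite big_geq.
rewrite add0r rowsS // natr_sum exchange_big /=; apply: eq_bigr => i _.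
by rewrite natr_sum; apply: eq_bigr => p _; rewrite natrM.
Qed.

Lemma sum_kleene (V : nmodType) (G : kleene -> V) :
  \sum_a G a = G KTrue + G KFalse + G KUnknown.
Proof.
rewrite (bigD1 KTrue) // (bigD1 KFalse) // (bigD1 KUnknown) //= big1; last by case.
by rewrite addr0 addrA.
Qed.

(** * Algebraic equations between the three series *)

Local Notation T := (rows_fps KTrue).
Local Notation F := (rows_fps KFalse).
Local Notation U := (rows_fps KUnknown).

Lemma rows_fps_kimp a :
  rows_fps a = fpsX + \sum_b \sum_c
    if kimp b c == a then rows_fps b * rows_fps c else 0.
Proof. by rewrite {1}rows_fpsE big_mkcond pair_bigA. Qed.

Lemma false_fpsE : F = fpsX + F * T.
Proof.
by rewrite {1}rows_fps_kimp !sum_kleene /= !(add0r, addr0) mulrC.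
Qed.

Lemma unknown_fpsE : U = fpsX + U * (T + F + U).
Proof.
rewrite {1}rows_fps_kimp !sum_kleene /=; ring.
Qed.

Lemma true_fpsE : T = fpsX + F * (T + F + U) + (T + U) * T.
Proof. rewrite {1}rows_fps_kimp !sum_kleene /=; ring. Qed.

Local Notation S := (T + F + U).

Lemma total_fpsE : S = 3%:R * fpsX + S ^+ 2.
Proof.
rewrite [X in X + _ + _ = _]true_fpsE [X in _ + X + _ = _]false_fpsE.
rewrite [X in _ + X = _]unknown_fpsE; ring.
Qed.

Lemma total_fps_sqr : S ^+ 2 = S - 3%:R * fpsX.
Proof. by rewrite [X in _ = X - _]total_fpsE [RHS]addrC addKr. Qed.

(** This cancels the unit [1 - B]: coefficient [n] of [A * B] involves only the coefficients of [A]
    below [n]. *)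
Lemma fps_mul_fixed_eq0 (A B : fps) : B 0%N = 0 -> A = A * B -> A = 0.
Proof.
move=> B0 eqA; apply: fpsP => n; have [m] := ubnP n; elim: m n => // m IHm n.
rewrite ltnS => le_nm; rewrite eqA fps_coefM big_ord_recr /= subnn B0 mulr0 addr0.
by apply: big1 => i _; rewrite IHm ?mul0r // (leq_trans (ltn_ord i)).
Qed.

(** Both [S] and [3 U] solve the linear equation [Y = 3 x + Y S], so their difference is fixed by
    multiplication by [S]. *)
Lemma unknown_third : S = 3%:R * U.
Proof.
apply/eqP; rewrite -subr_eq0; apply/eqP.
apply: (@fps_mul_fixed_eq0 _ S); first by rewrite /= !rows0.
have US : U * S = U - fpsX by rewrite [X in _ = X - _]unknown_fpsE [RHS]addrC addKr.
rewrite mulrBl -mulrA US -expr2 total_fps_sqr; ring.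
Qed.

Lemma true_false_fpsE : T = 2%:R * U - F.
Proof.
have -> : T = S - F - U by ring.
rewrite unknown_third; ring.
Qed.

Lemma false_fps_sqr : F ^+ 2 = fpsX - (1 - 2%:R * U) * F.
Proof.
have FT : F * T = F - fpsX by rewrite [X in _ = X - _]false_fpsE [RHS]addrC addKr.
have -> : F ^+ 2 = 2%:R * U * F - F * T by rewrite true_false_fpsE; ring.
rewrite FT; ring.
Qed.

(** * Closed forms by square roots *)

Lemma sqrt_unknown : fps_sqrt 1 (1 - 12%:R * fpsX) = 1 - 6%:R * U.
Proof.
apply: fps_sqrt_unique => //.
  have -> : 1 - 6%:R * U = 1 - 2%:R * S by rewrite unknown_third; ring.
  have -> : (1 - 2%:R * S) ^+ 2 = 1 - 4%:R * (S - S ^+ 2) by ring.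
  rewrite total_fps_sqr; ring.
by rewrite fps_coefB fps_mul_nat_coef /= rows0 mulr0 subr0.
Qed.

(** This completes the square in [false_fps_sqr], multiplied by 36: the root is [6 F + 3 (1 - 2 U)],
    with constant term 3. *)
Lemma sqrt_false :
  fps_sqrt 3%:R (5%:R + 24%:R * fpsX + 4%:R * (1 - 6%:R * U)) =
  6%:R * F + 3%:R - 6%:R * U.
Proof.
apply: fps_sqrt_unique => //; last first.
  rewrite fps_coefB fps_coefD !fps_mul_nat_coef -(mulr1 3%:R) fps_mul_nat_coef /=.
  by rewrite !rows0 !mulr0 subr0 add0r mulr1.
(* The two terms with [F] add up to [36 x]. The term in [U ^+ 2] is written through [3 U = S], so
   that [total_fps_sqr] makes it linear. *)
have -> : (6%:R * F + 3%:R - 6%:R * U) ^+ 2 =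
  36%:R * F ^+ 2 + 36%:R * (1 - 2%:R * U) * F + 9%:R - 36%:R * U + 4%:R * (3%:R * U) ^+ 2.
  by ring.
rewrite false_fps_sqr -unknown_third total_fps_sqr unknown_third; ring.
Qed.

(** * Coefficients of the total series by a differential equation *)

Definition fps_deriv (A : fps) : fps := Fps (fun n => n.+1%:R * A n.+1).

Lemma fps_coef_deriv (A : fps) n : fps_deriv A n = n.+1%:R * A n.+1.
Proof. by []. Qed.

Lemma fps_derivM (A B : fps) :
  fps_deriv (A * B) = fps_deriv A * B + A * fps_deriv B.
Proof.
apply: fpsP => n; rewrite fps_coefD [LHS]/= mulr_sumr.
(* The factor [n + 1] is split as [i + (n + 1 - i)]. *)
rewrite (eq_bigr (fun i : 'I_n.+2 => i%:R * A i * B (n.+1 - i)%N +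
                       A i * ((n.+1 - i)%:R * B (n.+1 - i)%N))).
  rewrite big_split /=; congr (_ + _).
    by rewrite big_ord_recl !mul0r add0r; apply: eq_bigr => i _.
  rewrite big_ord_recr /= subnn mul0r mulr0 addr0; apply: eq_bigr => i _.
  by rewrite subSn // -ltnS.
move=> i _; rewrite natrB -1?ltnS //; ring.
Qed.

Lemma fps_coefXM (A : fps) n : (fpsX * A) n.+1 = A n.
Proof.
rewrite fps_coefM 2!big_ord_recl /= mul0r add0r mul1r subSS subn0 big1 ?addr0 //.
by move=> i _; rewrite mul0r.
Qed.

(** Differentiating [S = 3 x + S ^ 2] gives [(1 - 2 S) S' = 3]; a further factor [1 - 2 S] makes
    this linear, as [(1 - 2 S) ^ 2 = 1 - 12 x]. *)
Lemma total_ode : fps_deriv S = 12%:R * (fpsX * fps_deriv S) + 3%:R - 6%:R * S.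
Proof.
have derivS : fps_deriv S = 3%:R + 2%:R * S * fps_deriv S.
  have derivX : fps_deriv (3%:R * fpsX) = 3%:R.
    apply: fpsP => n; rewrite fps_coef_deriv fps_mul_nat_coef.
    rewrite -[3%:R in RHS]mulr1 fps_mul_nat_coef /=.
    by case: n => [|n]; rewrite ?mulr1 ?mulr0 ?mul1r.
  have derivD (A B : fps) : fps_deriv (A + B) = fps_deriv A + fps_deriv B.
    by apply: fpsP => n; rewrite /= mulrDr.
  rewrite [X in fps_deriv X = _]total_fpsE [LHS]derivD derivX expr2 fps_derivM; ring.
have deriv_inv : (1 - 2%:R * S) * fps_deriv S = 3%:R.
  by rewrite mulrBl mul1r [X in X - _]derivS addrK.
have ode : (1 - 12%:R * fpsX) * fps_deriv S = 3%:R - 6%:R * S.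
  have -> : 1 - 12%:R * fpsX = (1 - 2%:R * S) ^+ 2.
    have -> : (1 - 2%:R * S) ^+ 2 = 1 - 4%:R * (S - S ^+ 2) by ring.
    rewrite total_fps_sqr; ring.
  rewrite expr2 -mulrA deriv_inv; ring.
rewrite -[RHS]addrA -ode; ring.
Qed.

Lemma catalanS n : (0 < n)%N ->
  n.+1%:R * catalan n.+1 = (4%:R * n%:R - 2%:R) * catalan n.
Proof.
case: n => // n _; rewrite /catalan [LHS]mulrA divff ?pnatr_eq0 // mul1r.
have -> : (2 * n.+2 - 2 = n.+1.*2)%N by rewrite mul2n doubleS subn2.
have -> : (2 * n.+1 - 2 = n.*2)%N by rewrite mul2n doubleS subn2.
rewrite !subSS !subn0.
(* Pascal's rule and symmetry here, then absorption in [bin2], give the ratio of consecutive central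
   binomials. *)
have bin1 : ('C(n.+1.*2, n.+1) = 2 * 'C(n.*2.+1, n))%N.
  rewrite doubleS binS mulSn mul1n; congr (_ + _)%N.
  by rewrite -bin_sub ?ltnS -addnn ?leq_addr // subSS addnK.
have bin2 : (n.+1 * 'C(n.*2.+1, n) = n.*2.+1 * 'C(n.*2, n))%N.
  have := mul_bin_left n.*2.+1 n; rewrite -mul_bin_diag.
  by rewrite -[X in (X - n)%N]addn1 -addnn -addnA addKn addn1 => ->.
have nz : n.+1%:R != 0 :> rat by rewrite pnatr_eq0.
apply: (mulfI nz); rewrite bin1 -[LHS]natrM mulnCA bin2 !natrM.
rewrite [RHS]mulrCA [X in _ = _ * X]mulrA divff // mul1r [LHS]mulrA.
congr (_ * _); rewrite -mul2n -!natr1 natrM; ring.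
Qed.

(** Comparing coefficients in [total_ode] gives the recurrence [catalanS] with an extra factor 3 at
    each step. *)
Lemma total_coef n : S n = 3%:R ^+ n * catalan n.
Proof.
(* At 0 both sides vanish: [catalan 0] is 0 because the inverse of 0 is 0. *)
case: n => [|n]; first by rewrite /= !rows0 /catalan invr0 mul0r mulr0.
elim: n => [|n IHn]; first by rewrite /= !rows1.
have const0 : (3%:R : fps) n.+1 = 0.
  by rewrite -[3%:R]mulr1 fps_mul_nat_coef mulr0.
apply: (@mulfI _ n.+2%:R); first by rewrite pnatr_eq0.
rewrite -fps_coef_deriv total_ode fps_coefB fps_coefD const0 addr0.
rewrite !fps_mul_nat_coef fps_coefXM fps_coef_deriv IHn.
rewrite [RHS]mulrCA (catalanS (ltn0Sn n)) [X in _ = X * _]exprS; ring.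
Qed.

Theorem proposition4 :
  [/\ false_rows 1 = 1%N,
      forall n : nat, (2 <= n)%N ->
        (false_rows n)%:R =
        \sum_(1 <= i < n)
          (false_rows i)%:R *
          (2%:R * catalan (n - i) * 3%:R ^+ (n - i - 1)
             - (false_rows (n - i))%:R) :> rat
    & Fps (fun n => if (1 <= n)%N then (false_rows n)%:R else 0) =
      (6%:R : rat)^-1 *:
        (- 2%:R - fps_sqrt 1 (1 - 12%:R * fpsX)
         + fps_sqrt 3%:R
             (5%:R + 24%:R * fpsX
              + 4%:R * fps_sqrt 1 (1 - 12%:R * fpsX)))].
Proof.
have false_rowsE n : false_rows n = rows KFalse n by exact: card_rows.
split; first by rewrite false_rowsE rows1.
  case=> [|[|n]] // _; rewrite false_rowsE -[LHS]/(F n.+2) false_fpsE.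
  rewrite fps_coefD add0r fps_coefM_inner /= ?rows0 //.
  apply: eq_big_nat => i /andP[i_gt0 lt_in]; rewrite !false_rowsE; congr (_ * _).
  (* The index [n.+2 - i] is positive, which gives meaning to the exponent [k - 1]. *)
  move: (n.+2 - i)%N (subn_gt0 i n.+2) => k; rewrite lt_in; case: k => // k _.
  rewrite -[LHS]/(T k.+1) true_false_fpsE fps_coefB fps_mul_nat_coef; congr (_ - _).
  (* Multiplying by 3 turns [U] into [S], whose coefficients are known. *)
  apply: (@mulfI _ 3%:R) => //; rewrite mulrCA -fps_mul_nat_coef -unknown_third.
  rewrite total_coef subSS subn0 exprS; ring.
have -> : Fps (fun n => if (1 <= n)%N then (false_rows n)%:R else 0) = F.
  by apply: fpsP => -[|n] /=; rewrite ?rows0 ?false_rowsE.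
rewrite sqrt_unknown sqrt_false.
have -> : - 2%:R - (1 - 6%:R * U) + (6%:R * F + 3%:R - 6%:R * U) = 6%:R * F by ring.
by rewrite mulr_natl -scaler_nat scalerA mulVf // scale1r.
Qed.
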